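(* Let $k\ge 0$ be an integer and let $G$ be the $(2k+1)\times(2k+1)$ grid graph. For any vertex $h$ of $G$, let $a(2k+1;h)$ denote the number of near-perfect matchings of $G$ in which $h$ is the unmatched vertex (equivalently, the number of perfect matchings of $G-h$). Then for every vertex $h$, $a(2k+1;h)$ is a multiple of $2^k$.
   Context: The $m\times n$ grid graph has vertex set $\{1,\dots,m\}\times\{1,\dots,n\}$, with two vertices adjacent when they differ by $1$ in exactly one coordinate. For a graph with an odd number of vertices, a near-perfect matching is a set of pairwise disjoint edges covering all vertices but one; the uncovered vertex is called the hole. *)

(* Defs.v *)
From mathcomp Require Import all_boot.
Set Implicit Arguments.
Unset Strict Implicit.
Unset Printing Implicit Defensive.

(* A simple graph on a finite type T is given by its adjacency relation. *)
Definition edges (T : finType) (adj : rel T) : {set {set T}} :=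
  [set [set p.1; p.2] | p : T * T & adj p.1 p.2].

Definition near_perfect_matching (T : finType) (adj : rel T) (h : T)
    (M : {set {set T}}) : bool :=
  [&& M \subset edges adj, trivIset M & cover M == [set~ h]].

Definition differ_by_one (i j : nat) : bool := (i.+1 == j) || (j.+1 == i).

(* The coordinates range over 0, ..., m - 1 and 0, ..., n - 1. *)
Definition grid_vertex (m n : nat) : finType := ('I_m * 'I_n)%type.

Definition grid_adj (m n : nat) : rel (grid_vertex m n) :=
  fun u v => (u.1 == v.1) && differ_by_one u.2 v.2
          || (u.2 == v.2) && differ_by_one u.1 v.1.

Definition num_near_perfect (n : nat) (h : grid_vertex n n) : nat :=
  #|[set M : {set {set grid_vertex n n}} |
      near_perfect_matching (@grid_adj n n) h M]|.

(* Main.v *)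
Require Import Defs.
From mathcomp Require Import all_boot.
From mathcomp Require Import all_order all_fingroup all_algebra zify ring.

(* Call a vertex dark when the sum of its coordinates is odd. A near-perfect
   matching exists only if the hole is light, and then it is a bijection from
   the dark vertices to the light vertices other than the hole.

   Signs. List the vertices in row-major order. Up to a factor depending only
   on the edges, the sign of this bijection is the parity of the number of
   crossing pairs of edges, an edge being the interval between its endpoints.
   To a vertical edge e attach the cells L(e) to the left of its lower endpoint,
   and to a horizontal edge the empty set. Two disjoint edges e, e' cross iff
   the number of endpoints of e' in L(e) plus the number of endpoints of e in
   L(e') is odd. Summing over all pairs, every vertex of L(e) other than the hole
   is counted once for each e, so the parity of the crossings is that of the sum over e of
   #|L(e) minus the hole|, a product of edge weights. With these weights as
   entries, the determinant of the dark-light adjacency matrix is, up to sign,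
   the number of near-perfect matchings.

   Divisibility. Let A be the adjacency matrix of the path on n = 2k + 1
   vertices. Since A^m commutes with A, the entries of A^m, seen as a function
   on the grid, sum over the neighbours of any vertex w to
   (A A^m + A^m A)(w) = 2 A^(m+1)(w). For each of the k dark vertices (0, a) of
   the first row, replace the row of (0, a) in the determinant by the
   combination of rows with coefficients A^a: this is unitriangular because
   A^a(0, j) is 0 for j > a and 1 for j = a, and makes k rows even. *)

Set Implicit Arguments.
Unset Strict Implicit.
Unset Printing Implicit Defensive.
Import Order.TTheory GRing.Theory Num.Theory.
Local Open Scope ring_scope.

(** * Determinants and products over pairs of indices *)

(** A permutation with a nonzero term lowers the rank [r] at every index it moves, yet it preserves
    the sum of all ranks; only the identity remains. The rank replaces the order of the indices,
    which need not fit the triangular shape. *)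
Lemma det_unitriangular (R : comNzRingType) N (U : 'M[R]_N) (r : 'I_N -> nat) :
    (forall i, U i i = 1) ->
    (forall i j, i != j -> (r i <= r j)%N -> U i j = 0) ->
  \det U = 1.
Proof.
move=> U1 U0; rewrite /determinant (bigD1 1%g) //= odd_perm1 expr0 mul1r.
rewrite big1 ?big1 ?addr0 // => [s s1|i _]; last by rewrite perm1 U1.
have [/existsP[i /andP[si ri]]|] :=
  boolP [exists i, (i != s i) && (r i <= r (s i))%N].
  by rewrite (bigD1 i) //= U0 // mul0r mulr0.
rewrite negb_exists => /forallP rs.
have {}rs i : i != s i -> (r (s i) < r i)%N.
  by move=> si; have := rs i; rewrite si /= -ltnNge.
have [i0 si0] : exists i0, i0 != s i0.
  apply/existsP; apply: contraNT s1; rewrite negb_exists => /forallP s1.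
  by apply/eqP/permP => i; rewrite perm1; apply/esym/eqP; move: (s1 i); rewrite negbK.
suff: (\sum_i r (s i) < \sum_i r i)%N.
  by rewrite [X in (_ < X)%N](reindex_perm s) ltnn.
rewrite [X in (X < _)%N](bigD1 i0) //= [X in (_ < X)%N](bigD1 i0) //=.
rewrite -addSn leq_add ?rs // leq_sum // => i _.
by have [<-//|/rs/ltnW] := eqVneq i (s i).
Qed.

Lemma dvdz_det_rows N (U W : 'M[int]_N) (d : 'I_N -> int) :
    \det U = 1 -> (forall i j, (d i %| (U *m W) i j)%Z) ->
  (\prod_i d i %| \det W)%Z.
Proof.
move=> U1 dUW; have -> : \det W = \det (U *m W) by rewrite det_mulmx U1 mul1r.
pose W' : 'M_N := \matrix_(i, j) ((U *m W) i j %/ d i)%Z.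
have -> : U *m W = diag_mx (\row_i d i) *m W'.
  apply/matrixP => i j; rewrite mul_diag_mx [RHS]mxE [W' i j]mxE.
  by rewrite [(\row_i0 d i0) _ _]mxE mulrC divzK.
rewrite det_mulmx det_diag; under eq_bigr do rewrite mxE.
exact: (dvdz_mulr _ (dvdzz _)).
Qed.

(** Both products are Vandermonde determinants, and [s] permutes the columns. *)
Lemma prod_perm_diff (R : comNzRingType) N (x : 'I_N -> R) (s : 'S_N) :
  \prod_(i < N) \prod_(j < N | (i < j)%N) (x (s j) - x (s i)) =
  (-1) ^+ s * \prod_(i < N) \prod_(j < N | (i < j)%N) (x j - x i).
Proof.
have V (y : 'I_N -> R) : \prod_(i < N) \prod_(j < N | (i < j)%N) (y j - y i) =
    \det (Vandermonde N (\row_i y i)).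
  by rewrite det_Vandermonde; do 2!apply: eq_bigr => ? _; rewrite !mxE.
rewrite (V (x \o s)) V.
have -> : Vandermonde N (\row_i x (s i)) = col_perm s (Vandermonde N (\row_i x i)).
  by apply/matrixP => i j; rewrite !mxE.
by rewrite col_permE det_mulmx det_perm odd_permV mulrC.
Qed.

Lemma prod_pairs (R : comNzRingType) N (g : 'I_N -> 'I_N -> R) :
  \prod_(i < N) \prod_(j < N | (i < j)%N) (g i j * g j i) =
  \prod_i \prod_(j | j != i) g i j.
Proof.
rewrite (eq_bigr _ (fun i _ => big_split _ _ _ _ _)) big_split /=.
rewrite [X in _ * X](exchange_big_dep predT) //= -big_split /=.
apply: eq_bigr => i _.
rewrite [RHS](bigID (fun j : 'I_N => (i < j)%N)) /=.
congr (_ * _); apply: eq_bigl => j; rewrite -(inj_eq val_inj) /=; lia.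
Qed.

(** * Matchings as permutations *)

(** Here [c] is a proper 2-colouring whose classes, without the hole, are enumerated by [b] and [w].
    A matching is [F s], where [s] sends [i] to the index of the partner of [b i]. *)
Lemma card_near_perfect (T : finType) (e : rel T) (c : pred T) (h : T)
    (N : nat) (b w : 'I_N -> T) :
    symmetric e -> (forall u v, e u v -> c u != c v) ->
    injective b -> injective w ->
    (forall v, reflect (exists i, v = b i) (c v)) ->
    (forall v, reflect (exists i, v = w i) (~~ c v && (v != h))) ->
    ~~ c h ->
  #|[set M | near_perfect_matching e h M]| =
  #|[set s : 'S_N | [forall i, e (b i) (w (s i))]]|.
Proof.
move=> eC ec injb injw bP wP ch.
pose F (s : 'S_N) : {set {set T}} := [set [set b i; w (s i)] | i : 'I_N].
have cb i : c (b i) by apply/bP; exists i.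
have /(_ _)/andP cw i : ~~ c (w i) && (w i != h) by apply/wP; exists i.
have bw i j : b i != w j.
  by apply: contraTneq (cb i) => ->; case: (cw j).
have trivF s : trivIset (F s).
  apply/trivIsetP => _ _ /imsetP[i _ ->] /imsetP[j _ ->].
  have [->|ij _] := eqVneq i j; first by rewrite eqxx.
  apply/pred0P => v /=; rewrite !inE; apply/negP.
  case/andP => /orP[]/eqP-> /orP[].
  - by rewrite (inj_eq injb) (negPf ij).
  - by rewrite (negPf (bw _ _)).
  - by rewrite eq_sym (negPf (bw _ _)).
  - by rewrite (inj_eq injw) (inj_eq perm_inj) (negPf ij).
have coverF s : cover (F s) = [set~ h].
  apply/setP => v; rewrite !inE; apply/bigcupP/idP => [[_ /imsetP[i _ ->]]|vh].
    rewrite !inE => /orP[]/eqP->; last by case: (cw (s i)).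
    by apply: contraTneq (cb i) => ->.
  have [/bP[i ->]|cv] := boolP (c v).
    by exists [set b i; w (s i)]; [apply: imset_f | rewrite !inE eqxx].
  have /wP[i ->] : ~~ c v && (v != h) by rewrite cv.
  exists [set b ((s^-1)%g i); w i]; last by rewrite !inE eqxx orbT.
  by apply/imsetP; exists ((s^-1)%g i); rewrite ?permKV.
have injF : injective F.
  move=> s t st; apply/permP => i.
  have : [set b i; w (s i)] \in F t by rewrite -st; apply: imset_f.
  case/imsetP => j _ /setP bj; apply: injw; apply/eqP.
  have ij : i = j.
    have := bj (b i); rewrite !inE eqxx (inj_eq injb) (negPf (bw i (t j))) orbF /=.
    by move/esym/eqP.
  rewrite -ij in bj.
  have := bj (w (s i)); rewrite !inE eqxx orbT.
  by rewrite eq_sym (negPf (bw _ _)).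
rewrite -(card_imset _ injF); apply: eq_card => M; rewrite !inE.
apply/and3P/imsetP => [[/subsetP Me trivM /eqP covM]|[s]]; last first.
  rewrite inE => /forallP es ->; split; rewrite ?trivF ?coverF //.
  apply/subsetP => _ /imsetP[i _ ->].
  by apply/imsetP; exists (b i, w (s i)); rewrite ?inE ?es.
have partner i : exists j, e (b i) (w j) && ([set b i; w j] \in M).
  have : b i \in cover M.
    by rewrite covM !inE; apply: contraTneq (cb i) => ->.
  case/bigcupP => S SM bS; have /imsetP[[u v]] := Me _ SM.
  rewrite inE /= => euv defS; rewrite defS in bS SM.
  wlog ub : u v euv bS SM {defS} / b i = u.
    move=> H; move: (bS); rewrite !inE => /orP[]/eqP bi; first exact: (H u v).
    by apply: (H v u); rewrite // 1?eC // setUC.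
  rewrite -ub in euv SM.
  have vh : v != h.
    have : v \in cover M by apply/bigcupP; exists [set b i; v]; rewrite ?inE ?eqxx ?orbT.
    by rewrite covM !inE.
  have cv : ~~ c v by have := ec _ _ euv; rewrite cb.
  have /wP[j jv] : ~~ c v && (v != h) by rewrite cv.
  by exists j; rewrite -jv euv SM.
pose f i := xchoose (partner i).
have fP i : e (b i) (w (f i)) /\ [set b i; w (f i)] \in M.
  by apply/andP/(xchooseP (partner i)).
have injf : injective f.
  move=> i j fij; apply: injb; apply/eqP.
  have [_ Mi] := fP i; have [_ Mj] := fP j.
  have := def_pblock trivM Mi (x := w (f i)).
  rewrite {3}fij (def_pblock trivM Mj) ?fij ?inE ?eqxx ?orbT // => /(_ isT).
  by move/setP/(_ (b i)); rewrite !inE eqxx (negPf (bw _ _)) orbF.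
exists (perm injf).
  by rewrite inE; apply/forallP => i; rewrite permE; case: (fP i).
have FM : F (perm injf) \subset M.
  by apply/subsetP => _ /imsetP[i _ ->]; rewrite permE; case: (fP i).
(* Both sets cover the same vertices, and [M] has only one block through each vertex. *)
apply/eqP; rewrite eqEsubset FM andbT; apply/subsetP => S SM.
have [v vS] : exists v, v \in S.
  by have /imsetP[[u v] _ ->] := Me _ SM; exists u; rewrite !inE eqxx.
have : v \in cover (F (perm injf)).
  by rewrite coverF -covM; apply/bigcupP; exists S.
case/bigcupP => S' S'F vS'; rewrite -(def_pblock trivM SM vS).
by rewrite (def_pblock trivM (subsetP FM _ S'F) vS').
Qed.

Section Grid.
Variable n : nat.
Local Notation V := (grid_vertex n n).
Local Notation adj := (@grid_adj n n).

(** * Crossing parity of two grid edges *)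

Definition pos (v : V) : int := Posz (v.1 * n + v.2).

Definition lex_lt (u v : V) : bool :=
  (u.1 < v.1)%N || (u.1 == v.1) && (u.2 < v.2)%N.

(* [below_left u v z] says that z lies in L(e) for the edge e = uv. *)
Definition below_left (u v z : V) : bool :=
  [&& u.1 != v.1, z.1 == maxn u.1 v.1 :> nat & (z.2 < u.2)%N].

Lemma sg_pos u v : u != v -> Num.sg (pos u - pos v) = (-1) ^+ lex_lt u v.
Proof.
case: u v => [i j] [i' j']; rewrite xpair_eqE /lex_lt /pos /= -!(inj_eq val_inj) /=.
have := ltn_ord j; have := ltn_ord j'.
move: (val i) (val i') (val j) (val j') => {j'}{}i {}i' {}j j' hj' hj uv.
have [lt|ge] := boolP (_ || _).
  by rewrite expr1; apply: ltr0_sg; nia.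
by rewrite expr0; apply: gtr0_sg; nia.
Qed.

(** For a vertical edge, these cells and those of [below_left] are the vertices strictly between the
    endpoints in row-major order. *)
Definition above_right (u v z : V) : bool :=
  [&& u.1 != v.1, z.1 == minn u.1 v.1 :> nat & (u.2 < z.2)%N].

Lemma lex_lt_straddle u v z : adj u v -> u != z -> v != z ->
  lex_lt u z (+) lex_lt v z = above_right u v z (+) below_left u v z.
Proof.
case: u v z => [a b] [c d] [i j].
rewrite /grid_adj /differ_by_one /lex_lt /above_right /below_left /=.
rewrite !xpair_eqE -!(inj_eq val_inj) /=.
move: (val a) (val b) (val c) (val d) (val i) (val j).
move=> {}a {}b {}c {}d {}i {}j.
case/orP => /andP[/eqP-> /orP[]/eqP<-]; lia.
Qed.

(** A horizontal edge has no cells, and by disjointness its endpoints lie both or neither in a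
    segment of the other edge. For two vertical edges, each side says that [u'v'] is further right
    and that the upper row of [uv] is a row of [u'v']. *)
Lemma above_right_below_left u v u' v' :
    adj u v -> adj u' v' -> u != u' -> v != v' -> u != v' -> v != u' ->
  above_right u v u' (+) above_right u v v' =
  below_left u' v' u (+) below_left u' v' v.
Proof.
case: u v u' v' => [a b] [c d] [a' b'] [c' d'].
rewrite /grid_adj /differ_by_one /above_right /below_left /=.
rewrite !xpair_eqE -!(inj_eq val_inj) /=.
move: (val a) (val b) (val c) (val d) (val a') (val b') (val c') (val d').
move=> {}a {}b {}c {}d {}a' {}b' {}c' {}d'.
do 2![case/orP => /andP[/eqP-> /orP[]/eqP<-]]; rewrite ?eqxx /=; lia.
Qed.

Lemma lex_lt_anti u v : u != v -> lex_lt u v = ~~ lex_lt v u.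
Proof.
case: u v => [a b] [c d].
by rewrite /lex_lt xpair_eqE -!(inj_eq val_inj) /=; lia.
Qed.

(* Two intervals with distinct endpoints cross iff the product of the four
   differences between endpoints of one and of the other is negative; one
   difference is reversed here, whence the sign. *)
Lemma crossing_sign u v u' v' :
    adj u v -> adj u' v' -> u != u' -> v != v' -> u != v' -> v != u' ->
  Num.sg ((pos u - pos u') * (pos v - pos v') *
          ((pos u - pos v') * (pos u' - pos v))) =
  - (-1) ^+ (below_left u v u' + below_left u v v' +
             (below_left u' v' u + below_left u' v' v)).
Proof.
move=> uv uv' n1 n2 n3 n4; rewrite !sgrM.
rewrite !sg_pos 1?(eq_sym u') // (lex_lt_anti (u := u')) 1?eq_sym //.
rewrite -!exprD -[RHS]mulN1r -exprS -[LHS]signr_odd -[RHS]signr_odd.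
rewrite !oddD !oddb /=; congr (_ ^+ nat_of_bool _).
have := lex_lt_straddle uv n1 n4; have := lex_lt_straddle uv n3 n2.
have := above_right_below_left uv uv' n1 n2 n3 n4.
move: (lex_lt u u') (lex_lt v u') (lex_lt u v') (lex_lt v v').
move: (above_right u v u') (above_right u v v').
move: (below_left u v u') (below_left u v v').
move: (below_left u' v' u) (below_left u' v' v).
by do 10!case.
Qed.

(** * Edge signs and the sign of a matching *)

(** The first factor records the order of the endpoints. In the second, [b] and [w] are meant to
    list all vertices but the hole. *)
Definition kasteleyn_sign (N : nat) (b w : 'I_N -> V) (u v : V) : int :=
  Num.sg (pos u - pos v) *
  (-1) ^+ (\sum_i (below_left u v (b i) + below_left u v (w i)))%N.

Lemma below_left_edge u v :
  adj u v -> (below_left u v u + below_left u v v)%N = 0%N.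
Proof.
case: u v => [a b] [c d]; rewrite /grid_adj /differ_by_one /below_left /=.
by rewrite -!(inj_eq val_inj) /=; lia.
Qed.

Lemma adj_neq u v : adj u v -> u != v.
Proof.
case: u v => [a b] [c d]; rewrite /grid_adj /differ_by_one xpair_eqE /=.
by rewrite -!(inj_eq val_inj) /=; lia.
Qed.

Lemma pos_inj : injective pos.
Proof.
move=> u v /eqP; apply: contraTeq => uv; rewrite -subr_eq0 -sgr_eq0.
by rewrite sg_pos // signr_eq0.
Qed.

(** Multiply the differences of positions over all dark, all light and all mixed pairs. In a fixed
    order this is [B * W * E]; listing the light vertices by partner costs the sign of [s]. Grouped
    by edges, each pair of edges gives a crossing sign and each edge its own endpoint difference. *)
Lemma kasteleyn_sign_const (N : nat) (b w : 'I_N -> V) :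
    injective b -> injective w -> (forall i j, b i != w j) ->
  exists2 kappa : int, kappa * kappa = 1 & forall s : 'S_N,
    (forall i, adj (b i) (w (s i))) ->
    (-1) ^+ s * \prod_i kasteleyn_sign b w (b i) (w (s i)) = kappa.
Proof.
move=> injb injw bw.
pose vdm (x : 'I_N -> int) :=
  \prod_(i < N) \prod_(j < N | (i < j)%N) (x j - x i).
pose B := vdm (pos \o b); pose W := vdm (pos \o w).
pose E := \prod_(i < N) \prod_(j < N) (pos (b i) - pos (w j)).
(* [C] collects the minus signs of [crossing_sign], one per pair of edges. *)
pose C : int := \prod_(i < N) \prod_(j < N | (i < j)%N) -1.
have sgP := big_morph Num.sg (@sgrM int) (@sgr1 int).
have vdm0 (x : 'I_N -> V) : injective x -> vdm (pos \o x) != 0.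
  move=> injx; apply/prodf_neq0 => i _; apply/prodf_neq0 => j ij.
  rewrite /= subr_eq0 (inj_eq pos_inj) (inj_eq injx) -(inj_eq val_inj) /=.
  by rewrite neq_ltn ij orbT.
have E0 : E != 0.
  apply/prodf_neq0 => i _; apply/prodf_neq0 => j _.
  by rewrite subr_eq0 (inj_eq pos_inj).
have CC : C * C = 1.
  rewrite -big_split big1 //= => i _; rewrite -big_split big1 //= => j _.
have sgsg (x : int) : x != 0 -> Num.sg x * Num.sg x = 1.
  by move=> x0; rewrite -sgrM -[x * x]expr2 gtr0_sg // exprn_even_gt0 //= x0.
exists (C * Num.sg (B * W * E)).
  by rewrite mulrACA CC mul1r sgsg // !mulf_neq0 ?vdm0.
move=> s bs.
pose c i j := (below_left (b i) (w (s i)) (b j) +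
               below_left (b i) (w (s i)) (w (s j)))%N.
pose g i j := pos (b i) - pos (w (s j)).
pose F i j := (pos (b j) - pos (b i)) * (pos (w (s j)) - pos (w (s i))) *
              (g i j * g j i).
pose R := \prod_(i < N) \prod_(j < N | (i < j)%N) F i j.
have R1 : R * \prod_i g i i = (-1) ^+ s * (B * W * E).
  have -> : R = B * ((-1) ^+ s * W) * \prod_i \prod_(j | j != i) g i j.
    rewrite -prod_perm_diff -prod_pairs -!big_split /=; apply: eq_bigr => i _.
    by rewrite -!big_split.
  rewrite -mulrA -big_split /=.
  have -> : \prod_i ((\prod_(j | j != i) g i j) * g i i) = E.
    apply: eq_bigr => i _; rewrite [RHS](reindex_perm s).
    by rewrite [RHS](bigD1 i) //= mulrC.
  by rewrite mulrCA !mulrA.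
have R2 : Num.sg R = C * \prod_i (-1) ^+ (\sum_j c i j)%N.
  (* No edge has an endpoint in its own [below_left], so the diagonal terms drop out. *)
  have -> : \prod_i (-1) ^+ (\sum_j c i j)%N =
            \prod_i \prod_(j | j != i) (-1) ^+ c i j :> int.
    apply: eq_bigr => i _; rewrite (bigD1 i) //= /c below_left_edge // add0n.
    by rewrite (big_morph _ (exprD _) (expr0 _)).
  rewrite -(prod_pairs (fun i j => (-1) ^+ c i j)) -big_split sgP.
  apply: eq_bigr => i _ /=; rewrite -big_split sgP; apply: eq_bigr => j ij /=.
  have ji : i != j by rewrite -(inj_eq val_inj) /= neq_ltn ij.
  rewrite -exprD mulN1r /F -(crossing_sign (bs i) (bs j)) ?(inj_eq injb) //.
  - by congr Num.sg; rewrite /g; ring.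
  - by rewrite (inj_eq injw) (inj_eq perm_inj).
  - by rewrite eq_sym.
rewrite big_split /= -sgP.
have -> : \prod_i (-1) ^+ (\sum_j (below_left (b i) (w (s i)) (b j) +
     below_left (b i) (w (s i)) (w j)))%N = C * Num.sg R.
  rewrite R2 mulrA CC mul1r; apply: eq_bigr => i _; congr (_ ^+ _).
  rewrite /c !big_split /=; congr (_ + _)%N.
  by rewrite [LHS](reindex_perm s).
transitivity (C * ((-1) ^+ s * Num.sg (R * \prod_i g i i))).
  rewrite sgrM -[Num.sg (\prod_i (_ - _))]/(Num.sg (\prod_i g i i)).
  by move: (_ ^+ s) (Num.sg R) (Num.sg (\prod_i _)) (C) => x y z t; ring.
by rewrite R1 sgrM sgrX sgrN1 signrMK.
Qed.

(** * Powers of the path matrix *)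

Definition path_mx : 'M[int]_n := \matrix_(i, j) (differ_by_one i j)%:R.

Lemma sum_grid_adj (M : 'M[int]_n) (w : V) :
  \sum_(u | adj u w) M u.1 u.2 = (path_mx *m M + M *m path_mx) w.1 w.2.
Proof.
(* The two ways of being adjacent exclude each other, so the disjunction becomes a sum: column
   neighbours give the first product, row neighbours the second. *)
have adjE (u : V) : (adj u w)%:R =
    (u.2 == w.2)%:R * (differ_by_one w.1 u.1)%:R +
    (u.1 == w.1)%:R * (differ_by_one u.2 w.2)%:R :> int.
  rewrite /grid_adj /differ_by_one orbC [(_ == val w.1) || _]orbC.
  by rewrite -!(inj_eq val_inj) /=; lia.
transitivity (\sum_(u : V) (adj u w)%:R * M u.1 u.2).
  by rewrite big_mkcond; apply: eq_bigr => u _; case: adj; rewrite ?mul1r ?mul0r.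
under eq_bigr => u _ do rewrite adjE mulrDl.
rewrite big_split /= mxE; congr (_ + _).
  rewrite -(pair_bigA _ (fun p q : 'I_n =>
    (q == w.2)%:R * (differ_by_one w.1 p)%:R * M p q)).
  rewrite mxE; apply: eq_bigr => p _; rewrite mxE (bigD1 w.2) //= eqxx mul1r.
  by rewrite big1 ?addr0 // => q /negPf->; rewrite !mul0r.
rewrite -(pair_bigA _ (fun p q : 'I_n =>
  (p == w.1)%:R * (differ_by_one q w.2)%:R * M p q)).
rewrite mxE (bigD1 w.1) //= [X in _ + X]big1 ?addr0 => [|p /negPf->].
  by apply: eq_bigr => q _; rewrite eqxx mul1r mulrC mxE.
by rewrite big1 // => q _; rewrite !mul0r.
Qed.

Lemma sum_grid_adj_exp m (w : V) :
  \sum_(u | adj u w) (path_mx ^+ m) u.1 u.2 = 2 * (path_mx ^+ m.+1) w.1 w.2.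
Proof.
rewrite sum_grid_adj [_ *m _](esym (exprS path_mx m)).
by rewrite [_ *m _](esym (exprSr path_mx m)) mxE mulr_natl.
Qed.

(** The entry counts walks of length [m] from an end of the path: none gets beyond [m], and only the
    straight one reaches it. *)
Lemma path_mx_exp_row0 m (i j : 'I_n) : i = 0%N :> nat -> (m <= j)%N ->
  (path_mx ^+ m) i j = (m == j)%:R.
Proof.
move=> i0; elim: m j => [|m IH] j mj; first by rewrite expr0 mxE -(val_eqE i j) /= i0.
have mn : (m < n)%N by rewrite (leq_trans mj) // ltnW.
rewrite exprSr mxE (bigD1 (Ordinal mn)) //= IH // eqxx mul1r mxE /=.
rewrite big1 ?addr0 => [|l lm]; first by rewrite /differ_by_one; congr (_%:R); lia.
have {}lm : l != m :> nat by rewrite -(inj_eq val_inj) in lm.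
have [ml|lm'] := leqP m l; first by rewrite IH // eq_sym (negPf lm) mul0r.
by rewrite mxE /differ_by_one; case: eqP; case: eqP => /=; rewrite ?mulr0; lia.
Qed.

(** * Dark and light vertices *)

Definition dark (v : V) : bool := odd (v.1 + v.2).

Lemma adj_dark u v : adj u v -> dark u != dark v.
Proof.
case: u v => [a b] [c d]; rewrite /grid_adj /differ_by_one /dark /=.
by rewrite -!(inj_eq val_inj) /=; lia.
Qed.

Lemma adj_sym : symmetric adj.
Proof.
by case=> [a b] [c d]; rewrite /grid_adj /differ_by_one /= -!(inj_eq val_inj) /=; lia.
Qed.

(** The sum factors into two alternating sums of [n] terms, each equal to 1. *)
Lemma sum_dark_sign : odd n -> \sum_(v : V) (-1) ^+ dark v = 1 :> int.
Proof.
move=> nodd.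
have alt m : \sum_(i < m) (-1) ^+ i = (odd m)%:R :> int.
  by elim: m => [|m IH]; rewrite ?big_ord0 // big_ord_recr /= IH -signr_odd; case: odd.
transitivity ((\sum_(i < n) (-1) ^+ i) * (\sum_(j < n) (-1) ^+ j) : int).
  rewrite big_distrl /=.
  rewrite -(pair_bigA _ (fun p q : 'I_n => (-1) ^+ odd (p + q))) /=.
  apply: eq_bigr => i _; rewrite big_distrr /=; apply: eq_bigr => j _.
  by rewrite signr_odd exprD.
by rewrite alt nodd.
Qed.

Lemma card_light_dark h : odd n -> ~~ dark h ->
  #|[set v | ~~ dark v && (v != h)]| = #|[set v | dark v]|.
Proof.
move=> nodd hl; have := sum_dark_sign nodd.
rewrite (bigD1 h) //= (negPf hl) expr0 (bigID dark) /=.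
rewrite -[RHS]addr0 => /addrI s0; apply/eqP.
rewrite -(eqr_nat int) -subr_eq0 addrC -[X in _ == X]s0; apply/eqP.
congr (_ + _).
  rewrite -sumr_const -sumrN; apply: eq_big => [v|v]; rewrite inE.
    by case: eqVneq => [->|]; rewrite ?(negPf hl) ?andbT ?andbF.
  by move=> ->.
rewrite -sumr_const; apply: eq_big => [v|v].
  by rewrite inE andbC.
rewrite inE => /andP[/negPf-> _].
by rewrite expr0.
Qed.

(** Every edge contributes 0 to the sum of [sum_dark_sign], so the hole alone must contribute 1. *)
Lemma near_perfect_hole_light h M :
  odd n -> near_perfect_matching adj h M -> ~~ dark h.
Proof.
move=> nodd /and3P[/subsetP Me trivM /eqP covM].
have := sum_dark_sign nodd; rewrite (bigD1 h) //=.
have -> : \sum_(v | v != h) (-1) ^+ dark v = 0 :> int.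
  transitivity (\sum_(v in cover M) (-1) ^+ dark v : int).
    by apply: eq_bigl => v; rewrite covM !inE.
  rewrite big_trivIset //= big1 // => S /Me/imsetP[[u v]].
  rewrite inE /= => uv ->; rewrite big_setU1 ?big_set1 ?inE ?adj_neq //.
  by have := adj_dark uv; case: (dark u); case: (dark v).
by rewrite addr0; case: dark.
Qed.

Lemma card_top_dark k : (k <= n./2)%N ->
  (k <= #|[set v : V | dark v & v.1 == 0 :> nat]|)%N.
Proof.
move=> kn; have n0 (t : 'I_k) : (0 < n)%N by case: t => t /=; lia.
have tn (t : 'I_k) : (t.*2.+1 < n)%N by case: t => t /=; lia.
pose f t : V := (Ordinal (n0 t), Ordinal (tn t)).
have injf : injective f.
  by move=> s t /(congr1 (fun v : V => val v.2)) /= st; apply/val_inj => /=; lia.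
rewrite -[k]card_ord -cardsT -(card_imset _ injf).
apply/subset_leq_card/subsetP => _ /imsetP[t _ ->].
by rewrite inE /dark /= odd_double.
Qed.

(** * The signed determinant and its even rows *)

Lemma dvdn_num_near_perfect k (h : V) : n = (2 * k + 1)%N ->
  (2 ^ k %| num_near_perfect h)%N.
Proof.
move=> nk; have nodd : odd n by rewrite nk; lia.
rewrite /num_near_perfect.
have [dh|hl] := boolP (dark h).
  rewrite (_ : [set _ | _] = set0) ?cards0 ?dvdn0 //.
  by apply/setP => M; rewrite !inE; apply: contraTF dh; apply: near_perfect_hole_light.
pose D := [set v : V | dark v]; pose L := [set v : V | ~~ dark v && (v != h)].
have LD : #|L| = #|D| by apply: card_light_dark.
pose b (i : 'I_#|D|) := enum_val i.
pose w (i : 'I_#|D|) := enum_val (cast_ord (esym LD) i).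
have injb : injective b by apply: enum_val_inj.
have injw : injective w by move=> i j /enum_val_inj/cast_ord_inj.
have bP v : reflect (exists i, v = b i) (dark v).
  apply: (iffP idP) => [dv|[i ->]]; last by have := enum_valP i; rewrite inE.
  have vD : v \in D by rewrite inE.
  by exists (enum_rank_in vD v); rewrite /b enum_rankK_in.
have wP v : reflect (exists i, v = w i) (~~ dark v && (v != h)).
  apply: (iffP idP) => [lv|[i ->]].
    have vL : v \in L by rewrite inE.
    by exists (cast_ord LD (enum_rank_in vL v)); rewrite /w cast_ordK enum_rankK_in.
  by have := enum_valP (cast_ord (esym LD) i); rewrite inE.
have db i : dark (b i) by apply/bP; exists i.
have lw i : ~~ dark (w i).
  by have /andP[] : ~~ dark (w i) && (w i != h) by apply/wP; exists i.
have bw i j : b i != w j by apply: contraTneq (db i) => ->; apply: lw.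
rewrite (card_near_perfect adj_sym adj_dark injb injw bP wP hl).
set G := [set s | _].
pose ks := kasteleyn_sign b w.
pose W : 'M[int]_#|D| :=
  \matrix_(i, j) if adj (b i) (w j) then ks (b i) (w j) else 0.
have [kappa kk kP] := kasteleyn_sign_const injb injw bw.
(* Permutations outside [G] meet a zero entry; each one in [G] contributes [kappa]. *)
have detW : \det W = kappa * #|G|%:R.
  rewrite /determinant (bigID (mem G)) /= addrC big1 ?add0r => [|s].
    rewrite mulr_natr -sumr_const; apply: eq_bigr => s.
    rewrite inE => /forallP bs; rewrite -(kP s bs); congr (_ * _).
    by apply: eq_bigr => i _; rewrite mxE bs.
  rewrite inE negb_forall => /existsP[i bs].
  by rewrite (bigD1 i) //= mxE (negPf bs) mul0r mulr0.
pose top i := (b i).1 == 0%N :> nat.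
pose U : 'M[int]_#|D| := \matrix_(i, j)
  if top i then (path_mx ^+ (b i).2) (b j).1 (b j).2 else (i == j)%:R.
have detU : \det U = 1.
  (* Top vertices are ranked by column. The successor keeps them above the other vertices, of rank
     0, where the entries of a top row are uncontrolled. *)
  apply: (@det_unitriangular _ _ _
    (fun i => if top i then (b i).2.+1 : nat else 0%N)) => [i|i j ij].
    by rewrite mxE; case: ifP => [/eqP ti|_]; rewrite ?path_mx_exp_row0 ?eqxx.
  rewrite mxE; case: ifP => [ti|_ _]; last by rewrite (negPf ij).
  case: ifP => // tj; rewrite ltnS => bij.
  rewrite path_mx_exp_row0 ?(eqP tj) //; case: eqP => // e.
  case/eqP: ij; apply: injb; apply/eqP.
  rewrite -[b i == b j]/((_ == _) && (_ == _)) -!(inj_eq val_inj) /=.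
  by rewrite e (eqP ti) (eqP tj) !eqxx.
have ks_odd i j : (2 %| ks (b i) (w j) - 1)%Z.
  rewrite /ks /kasteleyn_sign sg_pos // -exprD -signr_odd.
  by case: odd.
have UW i j : ((if top i then 2 else 1) %| (U *m W) i j)%Z.
  case: ifP => [ti|_]; last exact: dvd1z.
  set m := nat_of_ord (b i).2.
  pose S : int := \sum_(l | adj (b l) (w j)) (path_mx ^+ m) (b l).1 (b l).2.
  (* The signs are odd, so replacing them by 1 changes the entry by an even number and leaves
     [S]. *)
  have -> : (U *m W) i j = S + \sum_(l | adj (b l) (w j))
      (path_mx ^+ m) (b l).1 (b l).2 * (ks (b l) (w j) - 1).
    rewrite mxE -big_split [RHS]big_mkcond /=; apply: eq_bigr => l _.
    by rewrite !mxE ti; case: ifP => _; rewrite ?mulr0 //; ring.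
  apply: rpredD; last by apply: rpred_sum => l _; apply/dvdz_mull/ks_odd.
  (* All neighbours of the light vertex [w j] are dark, hence listed by [b]. *)
  have -> : S = \sum_(u | adj u (w j)) (path_mx ^+ m) u.1 u.2.
    rewrite [RHS](bigID dark) /=.
    rewrite [X in _ + X]big1 ?addr0 => [|u /andP[uw lu]]; last first.
      by have := adj_dark uw; rewrite (negPf lu) (negPf (lw j)).
    transitivity (\sum_(u in D | adj u (w j)) (path_mx ^+ m) u.1 u.2).
      by rewrite big_enum_val_cond.
    by apply: eq_bigl => u; rewrite inE andbC.
  by rewrite sum_grid_adj_exp dvdz_mulr.
have := dvdz_det_rows detU UW.
rewrite (bigID top) /= (eq_bigr (fun=> 2)) => [|i ->//].
rewrite prodr_const => topW.
have dW : (2 ^+ k %| \det W)%Z.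
  apply: dvdz_trans topW; apply: dvdz_mulr; apply: dvdz_exp2l.
  rewrite -(card_imset _ injb).
  apply: leq_trans (card_top_dark (k := k) _) _; first by rewrite nk; lia.
  apply/subset_leq_card/subsetP => v; rewrite inE => /andP[/bP[i ->] ti].
  by apply: imset_f.
have : (2 ^+ k %| (#|G|%:R : int))%Z.
  have -> : #|G|%:R = kappa * \det W by rewrite detW mulrA kk mul1r.
  exact: dvdz_mull.
by rewrite dvdzE abszX [#|G|%:R]natz.
Qed.

End Grid.

Local Close Scope ring_scope.

Theorem theorem1 (k : nat) (h : grid_vertex (2 * k + 1) (2 * k + 1)) :
  2 ^ k %| num_near_perfect h.
Proof. exact: dvdn_num_near_perfect. Qed.
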